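(* Fix an integer $s\ge 0$ and let $h_s$ be the sequence defined by $h_s(1)=h_s(2)=\cdots=h_s(s+2)=1$, $h_s(s+3)=2$, and $$h_s(n)=h_s\bigl(n-s-h_s(n-1)\bigr)+h_s\bigl(n-2-s-h_s(n-3)\bigr),\qquad n>s+3.$$ Then for every positive integer $n$, $h_s(n)=a_s(n)$, i.e. $h_s(n)$ equals the number of leaves of $\mathcal{T}_s$ among the nodes carrying a label at most $n$.
   Context: Fix an integer $s\ge 0$. Let $\mathcal{T}_s$ be the following infinite graph. It has super-nodes (level 0 nodes) $s_1,s_2,s_3,\dots$, with $s_{i+1}$ adjacent to $s_i$ for each $i\ge1$. Each super-node $s_i$ has $2^{i-1}$ children (level 1 nodes), called in left-to-right order the 1st, 2nd, $\dots$, $2^{i-1}$th child of $s_i$. Each level 1 node has exactly one child, a level 2 node, and level 2 nodes have no children. In addition there is one isolated node $I$. The leaves of $\mathcal{T}_s$ are the level 2 nodes together with $I$. Nodes are labelled by positive integers as follows: $I$ gets label $1$; then for $i=1,2,3,\dots$ in turn, the super-node $s_i$ receives the next $s$ consecutive unused labels (no label at all if $s=0$), and then for $r=1,2,\dots,2^{i-1}$ in turn, the $r$th child of $s_i$ receives the next unused label and then its child (a leaf) receives the next unused label. Thus each positive integer labels exactly one node; $I$ and all level 1 and level 2 nodes get exactly one label, and each super-node gets $s$ labels. For $n\ge1$ let $v_s(n)$ be the node with label $n$, let $d_s(n)=1$ if $v_s(n)$ is a leaf and $d_s(n)=0$ otherwise, and let $a_s(n)=\sum_{k=1}^n d_s(k)$.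 *)

(* Defs.v *)
From HB Require Import structures.
From mathcomp Require Import all_boot.

Set Implicit Arguments.
Unset Strict Implicit.
Unset Printing Implicit Defensive.

(* Super i is the super-node s_{i+1}; it has 2^i children.  Child i r is its
   (r+1)-st child, and GrandChild i r is the unique child of the latter.  The
   indices start at 0, so that this type is exactly the node set of T_s (which
   does not depend on s; only the labelling does). *)
Inductive node : Type :=
| Isolated
| Super (i : nat)
| Child (i : nat) (r : 'I_(2 ^ i))
| GrandChild (i : nat) (r : 'I_(2 ^ i)).

Definition edge (u v : node) : bool :=
  match u, v with
  | Super i, Super j => j == i.+1
  | Super i, @Child j _ => j == i
  | @Child i r, @GrandChild j t => (j == i) && (t == r :> nat)
  | _, _ => false
  end.

Definition adjacent (u v : node) : bool := edge u v || edge v u.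

Definition level (v : node) : option nat :=
  match v with
  | Isolated => None
  | Super _ => Some 0
  | @Child _ _ => Some 1
  | @GrandChild _ _ => Some 2
  end.

Definition is_leaf (v : node) : bool :=
  if v is Isolated then true else level v == Some 2.

(* The nodes that receive the labels of the (i+1)-st stage, in label order;
   enum 'I_(2 ^ i) lists the ordinals increasingly. *)
Definition stage (s i : nat) : seq node :=
  nseq s (Super i) ++
  flatten [seq [:: Child r; GrandChild r] | r <- enum 'I_(2 ^ i)].

(* The nodes in label order, up to the end of stage m. *)
Definition labelling (s m : nat) : seq node :=
  Isolated :: flatten [seq stage s i | i <- iota 0 m].

(* Every stage uses at least two labels, so n stages suffice to reach label n:
   see size_labelling and label_nodeE. *)
Definition label_node (s n : nat) : node := nth Isolated (labelling s n) n.-1.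

Lemma size_labelling (s m : nat) : m < size (labelling s m).
Proof.
rewrite /labelling /= ltnS; elim: m => [//|m IHm].
rewrite -addn1 iotaD map_cat flatten_cat size_cat /= cats0 leq_add //.
rewrite size_cat (leq_trans _ (leq_addl _ _)) // size_flatten /shape -map_comp.
have [x _] : exists x, x \in enum 'I_(2 ^ m).
  by exists (Ordinal (expn_gt0 2 m : 0 < 2 ^ m)); rewrite mem_enum.
case E: (enum _) => [|y l] //=.
by move/(congr1 size): E; rewrite size_enum_ord => E0; move: (expn_gt0 2 m); rewrite E0.
Qed.

Lemma label_nodeE (s n m : nat) : 0 < n -> n <= m ->
  nth Isolated (labelling s m) n.-1 = label_node s n.
Proof.
move=> n0 /subnKC <-; rewrite /label_node /labelling iotaD map_cat flatten_cat.
rewrite -cat_cons nth_cat ifT //.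
by apply: leq_ltn_trans (size_labelling s n); apply: leq_pred.
Qed.

Definition leaf_ind (s n : nat) : nat := is_leaf (label_node s n).

Definition leaf_count (s n : nat) : nat := \sum_(1 <= k < n.+1) leaf_ind s k.

(* Only the values h n with 0 < n matter.  Subtraction on nat is truncated, so
   out-of-range arguments would silently become 0: see hrec_in_range. *)
Definition hrec (s : nat) (h : nat -> nat) : Prop :=
  [/\ forall n, 1 <= n <= s + 2 -> h n = 1,
      h (s + 3) = 2 &
      forall n, s + 3 < n ->
        h n = h (n - s - h (n - 1)) + h (n - 2 - s - h (n - 3))].

(* The recursion only refers to earlier terms with positive index, so that it
   really defines a sequence. *)
Definition hrec_in_range (s : nat) (h : nat -> nat) : Prop :=
  forall n, s + 3 < n ->
    (0 < n - s - h (n - 1) < n) /\ (0 < n - 2 - s - h (n - 3) < n).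

(* Main.v *)
Require Import Defs.
From mathcomp Require Import all_boot zify.

(** Stage [i] (counted from 0) of the labelling starts after label
    [P i = s i + 2^(i+1) - 1], at which point [2^i] leaves have been met, and so
    [leaf_count s (P i + j) = 2^i + (j - s)./2] throughout stage [i].  Both
    arguments in the recursion for a label of stage [i + 1] fall into stage [i]
    (or on the first label after it), where this closed form turns the recursion
    into [c./2 + c.+1./2 = c]. *)

(** Children and grandchildren alternate, a non-leaf coming first, so every second label is a
    leaf. *)
Lemma stage_tail_count (i : nat) (l : seq 'I_(2 ^ i)) (j : nat) :
  j <= (size l).*2 ->
  count is_leaf (take j (flatten [seq [:: Child r; GrandChild r] | r <- l]))
  = j./2.
Proof.
elim: l j => [|r l IHl] [|[|j]] //= j_le.
by rewrite IHl //; lia.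
Qed.

Lemma size_stage (s i : nat) : size (stage s i) = s + 2 ^ i.+1.
Proof.
rewrite size_cat size_nseq size_flatten /shape -map_comp; congr (_ + _).
rewrite expnS -[in RHS](size_enum_ord (2 ^ i)).
by elim: (enum _) => //= r l ->; lia.
Qed.

(** Truncation in [j - s] accounts for the initial super-node labels, which contribute no leaf. *)
Lemma count_take_stage (s i j : nat) : j <= s + 2 ^ i.+1 ->
  count is_leaf (take j (stage s i)) = (j - s)./2.
Proof.
rewrite expnS => j_le; rewrite take_cat size_nseq.
have count_super k : count is_leaf (nseq k (Super i)) = 0.
  by rewrite count_nseq.
case: ltnP => [lt_js|le_sj].
  by rewrite take_nseq ?count_super; lia.
rewrite count_cat count_super stage_tail_count // size_enum_ord; lia.
Qed.

Lemma count_stage (s i : nat) : count is_leaf (stage s i) = 2 ^ i.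
Proof.
rewrite -[stage s i]take_size size_stage count_take_stage // expnS; lia.
Qed.

Lemma labellingD (s m k : nat) : labelling s (m + k) =
  labelling s m ++ flatten [seq stage s i | i <- iota m k].
Proof. by rewrite /labelling iotaD map_cat flatten_cat. Qed.

Lemma labellingS (s m : nat) :
  labelling s m.+1 = labelling s m ++ stage s m.
Proof. by rewrite -addn1 labellingD /= cats0. Qed.

Lemma size_labellingE (s m : nat) :
  (size (labelling s m)).+1 = s * m + 2 ^ m.+1.
Proof.
elim: m => [|m IHm]; first by rewrite muln0.
by rewrite labellingS size_cat size_stage -addSn IHm mulnS !expnS; lia.
Qed.

Lemma count_labelling (s m : nat) : count is_leaf (labelling s m) = 2 ^ m.
Proof.
elim: m => [//|m IHm].
by rewrite labellingS count_cat IHm count_stage expnS; lia.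
Qed.

Lemma leaf_count_take (s n m : nat) : n <= m ->
  leaf_count s n = count is_leaf (take n (labelling s m)).
Proof.
move=> le_nm; have lt_nsz := leq_ltn_trans le_nm (size_labelling s m).
rewrite /leaf_count; elim: n le_nm lt_nsz => [|n IHn] lt_nm lt_nsz.
  by rewrite big_nil take0.
rewrite big_nat_recr // IHn ?(ltnW lt_nm) ?(ltnW lt_nsz) //.
rewrite (take_nth Isolated) ?(ltnW lt_nsz) // -cats1 count_cat [count _ [:: _]]/= addn0.
by rewrite /leaf_ind -(@label_nodeE s n.+1 m).
Qed.

Lemma leaf_count_stage (s i j n : nat) :
    n.+1 = s * i + 2 ^ i.+1 + j -> j <= s + 2 ^ i.+1 ->
  leaf_count s n = 2 ^ i + (j - s)./2.
Proof.
rewrite -size_labellingE => -[def_n] le_j.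
(* Any bound [m >= n] would do; this one makes stages [0] to [i] an explicit prefix of the
   labelling. *)
rewrite (leaf_count_take s n (i.+1 + n)) ?leq_addl //.
rewrite labellingD labellingS -catA def_n take_cat ifN -?leqNgt ?leq_addr // addKn.
rewrite count_cat count_labelling takel_cat ?size_stage //.
by rewrite count_take_stage.
Qed.

(** The formula survives one label past the stage, because the next stage opens with a super-node
    or, if [s = 0], a child, never a leaf. *)
Lemma leaf_countE (s i j n : nat) :
    n.+1 = s * i + 2 ^ i.+1 + j -> j <= (s + 2 ^ i.+1).+1 ->
  leaf_count s n = 2 ^ i + (j - s)./2.
Proof.
move=> def_n; rewrite leq_eqVlt => /predU1P[def_j|]; last first.
  exact: leaf_count_stage.
have ->: leaf_count s n = 2 ^ i.+1 + (1 - s)./2.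
  by apply: leaf_count_stage; rewrite ?def_n ?def_j ?mulnS !expnS; lia.
by rewrite def_j !expnS; lia.
Qed.

Lemma stage_decomp (s n : nat) : 0 < n ->
  exists i j, n.+1 = s * i + 2 ^ i.+1 + j /\ j < s + 2 ^ i.+1.
Proof.
elim: n => // -[_ _|n /(_ isT)[i [j [def_n lt_j]]] _].
  by exists 0, 0; rewrite muln0 expn1; lia.
have [lt_j1|ge_j1] := ltnP j.+1 (s + 2 ^ i.+1).
  by exists i, j.+1; rewrite def_n addnS.
(* The last label of stage [i] is represented as offset [0] of stage [i.+1]. *)
exists i.+1, 0; rewrite def_n mulnS !expnS in ge_j1 lt_j *; lia.
Qed.

Lemma leaf_count_init (s n : nat) : 0 < n <= s + 3 ->
  leaf_count s n = (n == s + 3).+1.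
Proof.
by move=> n_range; rewrite (leaf_countE s 0 n.-1) ?muln0 ?expn1; lia.
Qed.

Lemma leaf_count_rec (s n : nat) : s + 3 < n ->
  [/\ 0 < n - s - leaf_count s (n - 1) < n,
      0 < n - 2 - s - leaf_count s (n - 3) < n &
      leaf_count s n = leaf_count s (n - s - leaf_count s (n - 1)) +
                       leaf_count s (n - 2 - s - leaf_count s (n - 3))].
Proof.
(* Decomposing [n.-1] gives [n] the offset [j.+1], so [n] and [n - 1] are covered by the formula of
   the same stage. Stage [0] is then excluded, as it ends at label [s + 3]. *)
move=> gt_n; have [|i [j [def_n lt_j]]] := stage_decomp s n.-1; first lia.
case: i => [|i] in def_n lt_j *; first by rewrite muln0 in def_n; lia.
have cE k p := leaf_countE s k p.
have pos2 := expn_gt0 2 i.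
have cur p m : m.+1 = s * i + s + 4 * 2 ^ i + p -> p <= s + 4 * 2 ^ i ->
    leaf_count s m = 2 * 2 ^ i + (p - s)./2.
  by move=> def_m le_p; rewrite (cE i.+1 p) ?mulnS !expnS; lia.
have prev p m : m.+1 = s * i + 2 * 2 ^ i + p -> p <= (s + 2 * 2 ^ i).+1 ->
    leaf_count s m = 2 ^ i + (p - s)./2.
  by move=> def_m le_p; rewrite (cE i p) ?expnS; lia.
rewrite mulnS !expnS in def_n lt_j.
move: (2 ^ i) (s * i) => x y in pos2 cur prev def_n lt_j *.
have c0 : leaf_count s n = 2 * x + (j.+1 - s)./2 by apply: cur; lia.
have c1 : leaf_count s (n - 1) = 2 * x + (j - s)./2 by apply: cur; lia.
(* For [j = s + 4 * x - 1] the argument is the first label after stage [i], the extra case of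
   [leaf_countE]. *)
have c1' : leaf_count s (n - s - leaf_count s (n - 1)) =
    x + (j.+1 - (j - s)./2 - s)./2 by clear c0; apply: prev; lia.
have r1 : 0 < n - s - leaf_count s (n - 1) < n by clear -c1 def_n pos2; lia.
rewrite c0 c1' r1; clear c0 c1 c1' r1.
(* For [j <= 1] the label [n - 3] still precedes the last leaf of the previous stage, whence
   [2 * x - 1]. *)
have [le_j1|gt_j1] := leqP j 1.
  have c3 : leaf_count s (n - 3) = 2 * x - 1.
    by rewrite (prev (s + 2 * x + j - 2)); lia.
  have c3' : leaf_count s (n - 2 - s - leaf_count s (n - 3)) =
    x + (j - s)./2 by apply: prev; lia.
  split; rewrite // ?c3'; first by clear -c3 def_n pos2 gt_n; lia.
  by clear -le_j1; lia.
have c3 : leaf_count s (n - 3) = 2 * x + (j - 2 - s)./2 by apply: cur; lia.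
have c3' : leaf_count s (n - 2 - s - leaf_count s (n - 3)) =
  x + (j.-1 - (j - 2 - s)./2 - s)./2 by apply: prev; lia.
split; rewrite // ?c3'; first by clear -c3 def_n pos2 gt_j1; lia.
(* With [c = (j.+1 - s)./2] and [j >= s + 2], the halved terms on the right are [c.+1] and [c]; for
   smaller [j] the second truncates to [0]. *)
by clear -gt_j1; lia.
Qed.

Theorem theorem2p3 (s : nat) :
  (exists h : nat -> nat, hrec s h) /\
  (forall h : nat -> nat, hrec s h ->
     hrec_in_range s h /\
     (forall n : nat, 0 < n -> h n = leaf_count s n)).
Proof.
split.
  exists (leaf_count s); split=> [n n_range||n /(leaf_count_rec s)[]//].
    by rewrite leaf_count_init; lia.
  by rewrite leaf_count_init ?eqxx; lia.
move=> h [h_init h_s3 h_rec].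
have hE n : 0 < n -> h n = leaf_count s n.
  elim/ltn_ind: n => n IHn n_gt0.
  have [le_n|gt_n] := leqP n (s + 3).
    rewrite leaf_count_init ?n_gt0 //.
    by case: eqP => [->|ne_n]; [rewrite h_s3 | rewrite h_init; lia].
  (* The range bounds make the induction hypothesis applicable to both outer arguments. *)
  have [/andP[? ?] /andP[? ?] ->] := leaf_count_rec s n gt_n.
  by rewrite h_rec // (IHn (n - 1)) ?(IHn (n - 3)) ?IHn; lia.
split=> // n gt_n; have [? ? _] := leaf_count_rec s n gt_n.
by rewrite !hE; lia.
Qed.
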